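(* Let $D$ be an integral domain which is not a field, $K$ its quotient field, $E$ a $K$-vector space, and $R:=D\ltimes E$ the trivial ring extension of $D$ by $E$. Then $\mathrm{G\text{-}gldim}(R)=\infty$.
   Context: All rings are commutative with identity and all modules are unital. The trivial ring extension $A\ltimes E$ of a ring $A$ by an $A$-module $E$ is the ring with underlying additive group $A\times E$ and multiplication $(a,e)(a',e')=(aa',ae'+a'e)$; here $E$ is regarded as a $D$-module via $D\subseteq K$. Let $S$ be a ring. An $S$-module $N$ is Gorenstein projective if there is an exact complex $\cdots\to P_1\to P_0\to P^0\to P^1\to\cdots$ of projective $S$-modules with $N\cong\mathrm{Im}(P_0\to P^0)$ that remains exact after applying $\mathrm{Hom}_S(-,Q)$ for every projective $S$-module $Q$. The Gorenstein projective dimension $\mathrm{Gpd}_S(N)$ is the least $n\geq 0$ such that there is an exact sequence $0\to G_n\to\cdots\to G_0\to N\to 0$ with all $G_i$ Gorenstein projective ($\infty$ if there is none). The Gorenstein global dimension of $S$ is $\mathrm{G\text{-}gldim}(S)=\sup\{\mathrm{Gpd}_S(N)\mid N\text{ an }S\text{-module}\}\in\{0,1,2,\dots\}\cup\{\infty\}$.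
   Formalization: The K-vector space E is assumed to be nonzero; for E = 0 the ring R is just D and the claim fails, e.g. for D = Z, where G-gldim(Z) is at most 1. *)

(* Defs.v *)
From HB Require Import structures.
From mathcomp Require Import all_boot all_order all_algebra.
From mathcomp Require Import boolp.

Set Implicit Arguments.
Unset Strict Implicit.
Unset Printing Implicit Defensive.

Import GRing.Theory.
Local Open Scope ring_scope.

(* Restriction of scalars: [restrict_scalars f M] is a copy of the carrier of
   the B-module M on which a : A acts as f a. *)
Definition restrict_scalars (A B : pzRingType) (f : {rmorphism A -> B})
  (M : lmodType B) : Type := M.

Section RestrictScalars.
Variables (A B : pzRingType) (f : {rmorphism A -> B}) (M : lmodType B).

HB.instance Definition _ := GRing.Zmodule.copy (restrict_scalars f M) M.

Let scale (a : A) (m : restrict_scalars f M) : restrict_scalars f M :=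
  f a *: (m : M).

Fact restrict_scalerA a b m : scale a (scale b m) = scale (a * b) m.
Proof. by rewrite /scale scalerA rmorphM. Qed.

Fact restrict_scale1r : left_id 1 scale.
Proof. by move=> m; rewrite /scale rmorph1 scale1r. Qed.

Fact restrict_scalerDr : right_distributive scale +%R.
Proof. by move=> a m m'; rewrite /scale scalerDr. Qed.

Fact restrict_scalerDl m : {morph scale^~ m : a b / a + b}.
Proof. by move=> a b; rewrite /scale rmorphD scalerDl. Qed.

HB.instance Definition _ := GRing.Zmodule_isLmodule.Build A
  (restrict_scalars f M) restrict_scalerA restrict_scale1r restrict_scalerDr
  restrict_scalerDl.

End RestrictScalars.

(* The trivial extension of A by E.  It is an alias of A * E because the
   product type may carry the componentwise ring structure. *)
Definition trivext (A : comPzRingType) (E : lmodType A) : Type := (A * E)%type.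

Section TrivialExtension.
Variables (A : comPzRingType) (E : lmodType A).

HB.instance Definition _ := GRing.Zmodule.copy (trivext E) (A * E)%type.

Definition trivext_one : trivext E := (1, 0).

Definition trivext_mul (x y : trivext E) : trivext E :=
  (x.1 * y.1, x.1 *: y.2 + y.1 *: x.2).

Fact trivext_mulA : associative trivext_mul.
Proof.
move=> x y z; congr pair => /=; first by rewrite mulrA.
by rewrite !scalerDr !scalerA addrA [z.1 * x.1]mulrC [z.1 * y.1]mulrC.
Qed.

Fact trivext_mulC : commutative trivext_mul.
Proof. by move=> x y; congr pair => /=; [rewrite mulrC | rewrite addrC]. Qed.

Fact trivext_mul1 : left_id trivext_one trivext_mul.
Proof.
by move=> [a e]; congr pair => /=; rewrite ?mul1r // scale1r scaler0 addr0.
Qed.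

Fact trivext_mulD : left_distributive trivext_mul +%R.
Proof.
move=> x y z; congr pair => /=; first by rewrite mulrDl.
by rewrite scalerDl scalerDr addrACA.
Qed.

HB.instance Definition _ := GRing.Zmodule_isComPzRing.Build (trivext E)
  trivext_mulA trivext_mulC trivext_mul1 trivext_mulD.

End TrivialExtension.

Section GorensteinDimension.
Variable S : comPzRingType.

Definition exact (M N P : lmodType S) (f : {linear M -> N})
  (g : {linear N -> P}) : Prop :=
  forall y : N, g y = 0 <-> exists x : M, f x = y.

Definition surjective (M N : lmodType S) (f : {linear M -> N}) : Prop :=
  forall y : N, exists x : M, f x = y.

Definition projective (P : lmodType S) : Prop :=
  forall (M N : lmodType S) (g : {linear M -> N}) (f : {linear P -> N}),
    surjective g -> exists h : {linear P -> M}, forall x, g (h x) = f x.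

(* The complex ... -> P_1 -> P_0 -> P^0 -> P^1 -> ... is indexed
   cohomologically: C i = P^i for i >= 0, C (- n - 1) = P_n for n >= 0.
   Thus d (-1) is the map P_0 -> P^0. *)
Definition totally_acyclic (C : int -> lmodType S)
  (d : forall i : int, {linear C i -> C (i + 1)}) : Prop :=
  [/\ forall i, projective (C i),
      forall i, exact (d i) (d (i + 1))
    & (* Hom(C (i + 2), Q) -> Hom(C (i + 1), Q) -> Hom(C i, Q) is exact *)
      forall (Q : lmodType S), projective Q ->
      forall (i : int) (f : {linear C (i + 1) -> Q}),
        (forall x, f (d i x) = 0) <->
        exists g : {linear C (i + 1 + 1) -> Q}, forall x, g (d (i + 1) x) = f x].

(* u identifies N with the image of d (-1). *)
Definition gorenstein_projective (N : lmodType S) : Prop :=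
  exists (C : int -> lmodType S)
         (d : forall i : int, {linear C i -> C (i + 1)}),
    totally_acyclic d /\
    exists u : {linear N -> C (-1 + 1)}, injective u /\
      forall y, (exists x, u x = y) <-> (exists x, d (-1) x = y).

(* 0 -> G_n -> ... -> G_0 -> N -> 0, written with G_i = 0 for i > n. *)
Definition gproj_resolution (N : lmodType S) (n : nat) : Prop :=
  exists (G : nat -> lmodType S) (d : forall i, {linear G i.+1 -> G i})
         (e : {linear G 0%N -> N}),
    [/\ forall i, (i <= n)%N -> gorenstein_projective (G i),
        forall i, (n < i)%N -> forall x : G i, x = 0,
        surjective e,
        exact (d 0%N) e
      & forall i, exact (d i.+1) (d i)].

End GorensteinDimension.

(* Elements of {0, 1, 2, ...} + {oo}. *)
Definition enat := option nat.
Definition enat_infty : enat := None.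
Definition enat_le (x y : enat) : bool :=
  match x, y with
  | _, None => true
  | None, Some _ => false
  | Some m, Some n => (m <= n)%N
  end.

(* The least n such that P n, and oo if there is none. *)
Definition least (P : nat -> Prop) : enat :=
  match pselect (exists n, `[< P n >]) with
  | left exP => Some (ex_minn exP)
  | right _ => enat_infty
  end.

Definition Gpd (S : comPzRingType) (N : lmodType S) : enat :=
  least (gproj_resolution N).

(* The supremum of Gpd N over all S-modules N: its least upper bound in enat. *)
Definition G_gldim (S : comPzRingType) : enat :=
  least (fun n => forall N : lmodType S, enat_le (Gpd N) (Some n)).

(* Main.v *)
(* Let R = D |x E, fix e0 != 0 in E and a K-linear form l on E with l e0 = 1.
   The ring map (d, e) |-> (d, l e) makes the dual numbers T = K |x K an
   R-module, a self-extension 0 -> K -> T -> K -> 0 whose inclusion k |-> (0, k)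
   is the composite of K -> R, k |-> (0, k e0), and R -> T, r |-> r (1, 0).  As
   the inclusion factors through a projective, K is a direct summand of
   Omega K (+) R, so Ext^k(K, R) embeds in Ext^(k+1)(K, R) for k >= 1.  If
   Gpd K is finite these groups vanish for large k, hence Ext^1(K, R) = 0 and
   K -> R extends to a map g : T -> R.  Then g(1, 0) has first component 1, and
   since (1, 0) is divisible in T by every nonzero a in D, D is a field. *)

Require Import Defs.
From HB Require Import structures.
From mathcomp Require Import all_boot all_order all_algebra.
From mathcomp Require Import boolp classical_sets.

Set Implicit Arguments.
Unset Strict Implicit.
Unset Printing Implicit Defensive.

Import GRing.Theory.
Local Open Scope ring_scope.

(** * Kernels as submodules *)

Section Kernel.
Variables (S : comPzRingType) (M N : lmodType S) (f : {linear M -> N}).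

Definition ker_pred : M -> bool := fun x => f x == 0.

Fact ker_closed : subsemimod_closed ker_pred.
Proof.
split; first split; first by apply/eqP; rewrite raddf0.
- by move=> x y /eqP fx /eqP fy; apply/eqP; rewrite raddfD /= fx fy addr0.
- by move=> a x /eqP fx; apply/eqP; rewrite linearZ /= fx scaler0.
Qed.

HB.instance Definition _ := GRing.isSubmodClosed.Build S M ker_pred ker_closed.

Record kernel := Kernel { kernel_val : M; _ : kernel_val \in ker_pred }.

HB.instance Definition _ := [isSub for kernel_val].
HB.instance Definition _ := [Choice of kernel by <:].
HB.instance Definition _ := [SubChoice_isSubLmodule of kernel by <:].

Lemma kernel_exists : exists (A : lmodType S) (i : {linear A -> M}),
  injective i /\ exact i f.
Proof.
exists kernel, (val : kernel -> M); split; first exact: val_inj.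
move=> y; split=> [fy0|[x <-]]; last by apply/eqP/(valP x).
have yP : y \in ker_pred by apply/eqP.
by exists (Kernel yP).
Qed.

End Kernel.

(** * Construction and factorization of linear maps *)

Section LinearGraph.
Variables (S : comPzRingType) (M N : lmodType S).

Lemma linear_bundle (f : M -> N) :
  linear f -> exists g : {linear M -> N}, forall x, g x = f x.
Proof.
move=> f_lin; pose F := GRing.isLinear.Build _ _ _ _ f f_lin.
by exists (HB.pack_for {linear M -> N} f F).
Qed.

(** Subtracting two pairs over the same [x] reduces uniqueness of values to the fibre over 0, so
    choosing values gives a function that is automatically linear. *)
Lemma linear_of_graph (G : M -> N -> Prop) :
    (forall x, exists y, G x y) ->
    (forall a x y x' y', G x y -> G x' y' -> G (a *: x + x') (a *: y + y')) ->
    (forall y, G 0 y -> y = 0) ->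
  exists f : {linear M -> N}, forall x, G x (f x).
Proof.
move=> Gtot Glin G0; pose f x := sval (cid (Gtot x)).
have fG x : G x (f x) by rewrite /f; case: cid.
have Gfun x y y' : G x y -> G x y' -> y = y'.
  move=> xy /(Glin (-1) _ _ _ _) /(_ xy); rewrite !scaleN1r addNr => /G0.
  by move/eqP; rewrite addrC subr_eq0 => /eqP.
have [|g gE] := @linear_bundle f.
  by move=> a x y; apply: Gfun (fG _) _; apply: Glin.
by exists g => x; rewrite gE.
Qed.

Lemma factor_inj (B : lmodType S) (i : {linear N -> B}) (u : {linear M -> B}) :
    injective i -> (forall x, exists y, i y = u x) ->
  exists v : {linear M -> N}, forall x, i (v x) = u x.
Proof.
move=> inj_i ui; apply: (linear_of_graph (G := fun x y => i y = u x)) => //.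
- by move=> a x y x' y' e e'; rewrite !linearP e e'.
- by move=> y; rewrite raddf0 -(raddf0 i) => /inj_i.
Qed.

Lemma factor_surj (B : lmodType S) (q : {linear B -> M}) (u : {linear B -> N}) :
    surjective q -> (forall b, q b = 0 -> u b = 0) ->
  exists v : {linear M -> N}, forall b, v (q b) = u b.
Proof.
move=> surj_q ker_u.
have [||y [b qb0 <-]|v vP] :=
    linear_of_graph (G := fun x y => exists2 b, q b = x & u b = y).
- by move=> x; have [b qb] := surj_q x; exists (u b), b.
- move=> a x y x' y' [b <- <-] [b' <- <-]; exists (a *: b + b').
    by rewrite linearP.
  by rewrite linearP.
- exact: ker_u.
exists v => b; have [b' /eqP] := vP (q b).
rewrite -subr_eq0 -raddfB => /eqP/ker_u /eqP.
by rewrite raddfB subr_eq0 => /eqP-> ->.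
Qed.

End LinearGraph.

(** * Short exact sequences and retracts up to a projective summand *)

Section StableRetract.
Variable S : comPzRingType.
Implicit Types A B C F M N P T : lmodType S.

Definition short_exact A B C (i : {linear A -> B}) (p : {linear B -> C}) :=
  [/\ injective i, exact i p & surjective p].

Lemma short_exact_comp0 A B C (i : {linear A -> B}) (p : {linear B -> C}) :
  short_exact i p -> forall x, p (i x) = 0.
Proof. by case=> _ ip _ x; apply/ip; exists x. Qed.

Lemma short_exact_factor A B C M (i : {linear A -> B}) (p : {linear B -> C})
    (u : {linear M -> B}) :
    short_exact i p -> (forall x, p (u x) = 0) ->
  exists v : {linear M -> A}, forall x, i (v x) = u x.
Proof. by case=> inj_i ip _ pu; apply: factor_inj => // x; apply/ip. Qed.

(* That is, M is a direct summand of A (+) P for some projective P. *)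
Definition stable_retract M A :=
  exists P (s : {linear M -> A}) (t : {linear A -> M})
    (j : {linear M -> P}) (b : {linear P -> M}),
  projective P /\ forall x, t (s x) + b (j x) = x.

(** The maps between [M] and [A] lift to the projective covers and restrict to the kernels. The
    clause relating [s] to [s1] is what later allows a map on [B] extended to [P] to be pulled back
    to [F]. *)
Lemma syzygy_stable_retract C F M B P A
    (i : {linear C -> F}) (p : {linear F -> M})
    (i' : {linear B -> P}) (p' : {linear P -> A}) :
    projective F -> short_exact i p -> projective P -> short_exact i' p' ->
    stable_retract M A ->
  exists (s : {linear C -> B}) (s1 : {linear F -> P})
    (t : {linear B -> C}) (b : {linear F -> C}),
  (forall c, i' (s c) = s1 (i c)) /\ (forall c, t (s c) + b (i c) = c).
Proof.
move=> Fproj Sip Pproj Sip' [Q [s0 [t0 [j [b0 [Qproj st]]]]]].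
have [inj_i _ surj_p] := Sip; have [_ _ surj_p'] := Sip'.
have [s1 s1P] := Fproj _ _ p' (s0 \o p) surj_p'.
have [t1 t1P] := Pproj _ _ p (t0 \o p') surj_p.
have [b1 b1P] := Qproj _ _ p b0 surj_p.
have [s sP] : exists s : {linear C -> B}, forall c, i' (s c) = (s1 \o i) c.
  apply: (short_exact_factor Sip') => c /=.
  by rewrite s1P /= (short_exact_comp0 Sip) raddf0.
have [t tP] : exists t : {linear B -> C}, forall c, i (t c) = (t1 \o i') c.
  apply: (short_exact_factor Sip) => c /=.
  by rewrite t1P /= (short_exact_comp0 Sip') raddf0.
(* The identity of [F] minus the lift of [t0 s0 + b0 j] is killed by [p], hence lands in [C]. *)
have [b bP] : exists b : {linear F -> C}, forall x,
    i (b x) = (idfun \- (t1 \o s1 \+ (b1 \o j \o p))) x.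
  apply: (short_exact_factor Sip) => x /=.
  by rewrite raddfB raddfD /= t1P /= s1P /= b1P st subrr.
exists s, s1, t, b; split=> // c; apply: inj_i.
rewrite raddfD /= tP bP /= sP /= (short_exact_comp0 Sip) !raddf0 addr0.
by rewrite addrC subrK.
Qed.

(* Lifting P -> T -> N to the cover F of N splits P -> T into a map through F
   and a map b into M; on M the former lands in A, which decomposes the identity
   of M as t s + b j. *)
Lemma stable_retract_syzygy M T N P A F (i : {linear M -> T})
    (q : {linear T -> N}) (j : {linear M -> P}) (tau : {linear P -> T})
    (iota : {linear A -> F}) (p : {linear F -> N}) :
    short_exact i q -> projective P -> (forall x, tau (j x) = i x) ->
    projective F -> short_exact iota p ->
  stable_retract M A.
Proof.
move=> Siq Pproj tauj Fproj Sip.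
have [inj_i _ surj_q] := Siq; have [_ _ surj_p] := Sip.
have [phi phiP] := Fproj _ _ q p surj_q.
have [a aP] := Pproj _ _ p (q \o tau) surj_p.
have [b bP] : exists b : {linear P -> M}, forall x,
    i (b x) = (tau \- (phi \o a)) x.
  apply: (short_exact_factor Siq) => x /=.
  by rewrite raddfB /= phiP aP subrr.
have [s sP] : exists s : {linear M -> A}, forall x, iota (s x) = (a \o j) x.
  apply: (short_exact_factor Sip) => x /=.
  by rewrite aP /= tauj (short_exact_comp0 Siq).
have [t tP] : exists t : {linear A -> M}, forall x, i (t x) = (phi \o iota) x.
  apply: (short_exact_factor Siq) => x /=.
  by rewrite phiP (short_exact_comp0 Sip).
exists P, s, t, j, b; split=> // x; apply: inj_i.
by rewrite raddfD /= tP bP /= sP tauj addrC subrK.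
Qed.

End StableRetract.

(** * Projectivity of the regular module and of direct sums *)

Section ProjectiveModules.
Variable S : comPzRingType.

Lemma regular_projective : projective (S^o : lmodType S).
Proof.
move=> M N g f surj_g; have [m gm] := surj_g (f 1).
have [|h hE] := @linear_bundle S S^o M (fun r => (r : S) *: m).
  by move=> a x y; rewrite scalerDl scalerA.
exists h => x; rewrite hE linearZ /= gm -linearZ /=.
by rewrite -[LHS]/(f (x * 1)) mulr1.
Qed.

Lemma pair_projective (P P' : lmodType S) :
  projective P -> projective P' -> projective (P * P')%type.
Proof.
move=> Pproj P'proj M N g f surj_g.
have [|l1 l1E] := @linear_bundle _ P (P * P')%type (fun x => (x, 0)).
  by move=> a x y; congr pair; rewrite /= scaler0 addr0.
have [|l2 l2E] := @linear_bundle _ P' (P * P')%type (fun x => (0, x)).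
  by move=> a x y; congr pair; rewrite /= scaler0 addr0.
have [h1 h1P] := Pproj _ _ g (f \o l1) surj_g.
have [h2 h2P] := P'proj _ _ g (f \o l2) surj_g.
exists ((h1 \o fst) \+ (h2 \o snd)) => -[x y] /=.
rewrite raddfD /= h1P h2P /= l1E l2E -raddfD; congr (f _).
by congr pair; rewrite /= ?addr0 ?add0r.
Qed.

End ProjectiveModules.

(** * Vanishing of Ext by dimension shifting *)

Section ExtVanishing.
Variables (S : comPzRingType) (Q : lmodType S).
Implicit Types A B C F G H M N P T Z : lmodType S.

(* Ext^(k+1)(M, Q) = 0 (note the shift), computed from some partial projective
   resolution of M. *)
Fixpoint ext_vanish (k : nat) (M : lmodType S) : Prop :=
  exists (A P : lmodType S) (i : {linear A -> P}) (p : {linear P -> M}),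
    [/\ projective P, short_exact i p
      & if k is k'.+1 then ext_vanish k' A else
        forall f : {linear A -> Q}, exists g : {linear P -> Q},
          forall x, g (i x) = f x].

(** Carried as a hypothesis; in the main argument it follows from the Gorenstein projective
    resolutions themselves. *)
Definition enough_projectives : Prop :=
  forall M, exists P (p : {linear P -> M}), projective P /\ surjective p.

Lemma enough_projectives_cover : enough_projectives ->
  forall M, exists A P (i : {linear A -> P}) (p : {linear P -> M}),
    projective P /\ short_exact i p.
Proof.
move=> enough M; have [P [p [Pproj surj_p]]] := enough M.
by have [A [i [inj_i ip]]] := kernel_exists p; exists A, P, i, p.
Qed.

(** Being a stable retract passes to syzygies, which drives the induction. With [M = A] it also
    shows that the choice of resolution is immaterial. *)
Lemma ext_vanish_retract k M A : enough_projectives ->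
  stable_retract M A -> ext_vanish k A -> ext_vanish k M.
Proof.
move=> enough; elim: k M A => [|k IHk] M A MA [B [P [i' [p' [Pproj Sip' BQ]]]]];
have [C [F [i [p [Fproj Sip]]]]] := enough_projectives_cover enough M;
have [s [s1 [t [b [sE stb]]]]] := syzygy_stable_retract Fproj Sip Pproj Sip' MA;
exists C, F, i, p; split=> //; last first.
  by apply: (IHk _ B) => //; exists F, s, t, i, b.
move=> f; have [g gP] := BQ (f \o t).
(* On [C] the first summand restricts to [f t s], and the second supplies the remainder [f b i]. *)
exists ((g \o s1) \+ (f \o b)) => c /=.
by rewrite -sE gP /= -raddfD stb.
Qed.

(** Lifting [pZ] through [q] yields a cover of [A] by [P * P'], whose kernel is an extension of [Z']
    by [H']. The last two clauses let maps extended over [P] and over [P'] be glued. *)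
Lemma horseshoe A Z H H' Z' P P' (i : {linear H -> A}) (q : {linear A -> Z})
    (iH : {linear H' -> P}) (pH : {linear P -> H})
    (iZ : {linear Z' -> P'}) (pZ : {linear P' -> Z}) :
    short_exact i q -> short_exact iH pH ->
    projective P' -> short_exact iZ pZ ->
  exists A' (iA : {linear A' -> (P * P')%type})
    (pA : {linear (P * P')%type -> A})
    (i' : {linear H' -> A'}) (q' : {linear A' -> Z'}),
  [/\ short_exact iA pA, short_exact i' q',
      forall h, iA (i' h) = (iH h, 0) & forall a, iZ (q' a) = (iA a).2].
Proof.
move=> Siq SH P'proj SZ.
have [inj_i iq surj_q] := Siq; have [inj_iH ipH surj_pH] := SH.
have [inj_iZ ipZ surj_pZ] := SZ.
have [l lP] := P'proj _ _ q pZ surj_q.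
pose pA : {linear (P * P')%type -> A} := (i \o pH \o fst) \+ (l \o snd).
have [A' [iA [inj_iA ipA]]] := kernel_exists pA.
have pA_surj : surjective pA.
  move=> a; have [y qy] := surj_pZ (q a).
  have [|h ih] := (iq (a - l y)).1; first by rewrite raddfB /= lP qy subrr.
  have [x px] := surj_pH h; exists (x, y) => /=.
  by rewrite px ih subrK.
have [|inl inlE] := @linear_bundle _ H' (P * P')%type (fun h => (iH h, 0)).
  by move=> a x y; congr pair; rewrite /= ?linearP// scaler0 addr0.
have [i' i'P] : exists i' : {linear H' -> A'}, forall h, iA (i' h) = (iH h, 0).
  have [|i' i'P] := factor_inj (u := inl) inj_iA; last first.
    by exists i' => h; rewrite i'P inlE.
  move=> h; apply/ipA; rewrite inlE.
  by rewrite /= (short_exact_comp0 SH) !raddf0 addr0.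
have [q' q'P] : exists q' : {linear A' -> Z'},
    forall a, iZ (q' a) = (snd \o iA) a.
  apply: (short_exact_factor SZ) => a /=.
  have /(congr1 q) := (ipA (iA a)).2 (ex_intro _ a erefl).
  by rewrite raddf0 raddfD /= (short_exact_comp0 Siq) add0r lP.
exists A', iA, pA, i', q'; split=> //; split.
- by move=> h h' /(congr1 iA); rewrite !i'P => -[/inj_iH].
- move=> a; split=> [q'a|[h <-]].
    have a2 : (iA a).2 = 0 by have := q'P a; rewrite q'a raddf0.
    have := (ipA (iA a)).2 (ex_intro _ a erefl).
    rewrite /= a2 raddf0 addr0 -(raddf0 i) => /inj_i /ipH[h hE].
    exists h; apply: inj_iA; rewrite i'P /= hE -a2.
    by case: (iA a).
  by apply: inj_iZ; rewrite q'P /= i'P /= raddf0.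
- move=> z; have [|h ih] := (iq (l (iZ z))).1.
    by rewrite lP (short_exact_comp0 SZ).
  have [x px] := surj_pH h.
  have [|a aE] := (ipA (- x, iZ z)).1.
    by rewrite /= !raddfN /= px ih addNr.
  by exists a; apply: inj_iZ; rewrite q'P /= aE.
Qed.

(** Exactness of the long Ext sequence at its middle term, obtained by replacing the extension with
    that of the syzygies. *)
Lemma ext_vanish_extension k A Z H (i : {linear H -> A}) (q : {linear A -> Z}) :
  short_exact i q -> ext_vanish k H -> ext_vanish k Z -> ext_vanish k A.
Proof.
elim: k A Z H i q => [|k IHk] A Z H i q Siq [H' [P [iH [pH [Pproj SH H'Q]]]]];
move=> [Z' [P' [iZ [pZ [P'proj SZ Z'Q]]]]];
have [A' [iA [pA [i' [q' [SA Siq' i'P q'P]]]]]] := horseshoe Siq SH P'proj SZ;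
exists A', (P * P')%type, iA, pA; split=> //; try exact: pair_projective;
  last exact: IHk Siq' H'Q Z'Q.
move=> f; have [g1 g1P] := H'Q (f \o i').
(* After the part of [f] seen on [H'] is subtracted, the difference descends to [Z'], where it can
   be extended to [P']. *)
have [||v vP] := @factor_surj _ _ _ _ q' (f \- (g1 \o fst \o iA)).
- by case: Siq'.
- case: Siq' => _ ex_iq _ a /ex_iq[h <-] /=.
  by rewrite i'P /= g1P subrr.
have [g2 g2P] := Z'Q v.
exists ((g1 \o fst) \+ (g2 \o snd)) => a /=.
by rewrite -q'P g2P vP /= addrC subrK.
Qed.

(** The kernel of the composite cover [P -> G -> M] is an extension of [Z] by the syzygy [H] of
    [G]. *)
Lemma ext_vanish_quotient k Z G M (i : {linear Z -> G}) (q : {linear G -> M}) :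
  short_exact i q -> ext_vanish k Z -> ext_vanish k.+1 G -> ext_vanish k.+1 M.
Proof.
move=> Siq ZQ [H [P [iH [pH [Pproj SH HQ]]]]].
have [inj_i iq surj_q] := Siq; have [inj_iH ipH surj_pH] := SH.
have [A [iA [inj_iA ipA]]] := kernel_exists (q \o pH).
have surj : surjective (q \o pH).
  move=> m; have [y <-] := surj_q m; have [x <-] := surj_pH y.
  by exists x.
exists A, P, iA, (q \o pH); split=> //.
have [i' i'P] : exists i' : {linear H -> A}, forall h, iA (i' h) = iH h.
  apply: factor_inj => // h; apply/ipA.
  by rewrite /= (short_exact_comp0 SH) raddf0.
have [q' q'P] : exists q' : {linear A -> Z}, forall a, i (q' a) = (pH \o iA) a.
  apply: factor_inj => // a; apply/iq.
  exact: (ipA (iA a)).2 (ex_intro _ a erefl).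
apply: (@ext_vanish_extension _ _ _ _ i' q') HQ ZQ; split.
- by move=> h h' /(congr1 iA); rewrite !i'P => /inj_iH.
- move=> a; split=> [q'a|[h <-]].
    have /ipH[h hE] : pH (iA a) = 0 by have := q'P a; rewrite q'a raddf0.
    by exists h; apply: inj_iA; rewrite i'P.
  by apply: inj_i; rewrite q'P /= i'P (short_exact_comp0 SH) raddf0.
- move=> z; have [x px] := surj_pH (i z).
  have [|a aE] := (ipA x).1; first by rewrite /= px (short_exact_comp0 Siq).
  by exists a; apply: inj_i; rewrite q'P /= aE.
Qed.

(** Syzygies of an image in the complex are the images one place to the left, so the induction only
    shifts [i]; the base case is exactness of the complex under Hom into [Q]. *)
Lemma totally_acyclic_ext_vanish (C : int -> lmodType S)
    (d : forall i : int, {linear C i -> C (i + 1)}) k i N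
    (u : {linear N -> C (i + 1)}) :
    projective Q -> totally_acyclic d -> injective u ->
    (forall y, (exists x, u x = y) <-> (exists x, d i x = y)) ->
  ext_vanish k N.
Proof.
move=> Qproj [Cproj ex_d Hom_d].
have shift (j : int) : exists j', j = j' + 1 by exists (j - 1); rewrite subrK.
(* Writing [i] as [j + 1] makes the kernel of the cover [C (j + 1) -> N] the image of [d j], with no
   cast between indices. *)
elim: k i N u => [|k IHk] i N u inj_u u_im; have [j Ej] := shift i; subst i;
have [p pP] : exists p : {linear C (j + 1) -> N}, forall x, u (p x) = d _ x by
  [apply: factor_inj => // x; apply/u_im; exists x];
have [A [iA [inj_iA ipA]]] := kernel_exists p;
have surj_p : surjective p by
  [move=> n; have [x xE] := (u_im (u n)).1 (ex_intro _ n erefl);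
   exists x; apply: inj_u; rewrite pP];
have iA_im y : (exists x, iA x = y) <-> (exists x, d j x = y) by
  [rewrite -ex_d -ipA -pP; split=> [->|];
   rewrite ?raddf0 -?(raddf0 u)// => /inj_u];
exists A, (C (j + 1)), iA, p; split=> //; last exact: IHk inj_iA iA_im.
have [j' Ej] := shift j; subst j => f.
have [w wP] : exists w : {linear C (j' + 1) -> A}, forall x, iA (w x) = d _ x.
  by apply: factor_inj => // x; apply/iA_im; exists x.
have [|g gP] := (Hom_d Q Qproj j' (f \o w)).1.
  move=> x /=; suff -> : w (d j' x) = 0 by rewrite raddf0.
  by apply: inj_iA; rewrite wP raddf0; apply/ex_d; exists x.
exists g => a; have [x xE] := (iA_im (iA a)).1 (ex_intro _ a erefl).
by rewrite -xE gP /=; congr (f _); apply: inj_iA; rewrite wP.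
Qed.

Lemma gorenstein_projective_ext_vanish k G :
  projective Q -> gorenstein_projective G -> ext_vanish k G.
Proof.
move=> Qproj [C [d [dTA [u [inj_u u_im]]]]].
exact: totally_acyclic_ext_vanish Qproj dTA inj_u u_im.
Qed.

(** Induction on the length: the kernel of [e] has a resolution shorter by one, and passing from it
    back to [N] raises the Ext degree by one. *)
Lemma gproj_resolution_ext_vanish n N :
    enough_projectives -> projective Q -> gproj_resolution N n ->
  ext_vanish n N.
Proof.
move=> enough Qproj; elim: n N => [|n IHn] N [G [d [e]]].
  move=> [Ggp G0 surj_e de _].
  have inj_e : injective e.
    move=> x y /eqP; rewrite -subr_eq0 -raddfB => /eqP/de[z].
    rewrite (G0 1%N isT z) raddf0 => /esym/eqP.
    by rewrite subr_eq0 => /eqP.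
  apply: (@ext_vanish_retract _ _ (G 0%N)) => //; last first.
    exact/gorenstein_projective_ext_vanish/Ggp.
  (* As [G 1] is zero, [e] is an isomorphism; its inverse gives a stable retract with zero
     remainder. *)
  have [s sP] := factor_inj (u := idfun : {linear N -> N}) inj_e surj_e.
  exists S^o, s, e, \0, \0; split; first exact: regular_projective.
  by move=> x; rewrite sP /= addr0.
move=> [Ggp G0 surj_e de dd].
have [Z [i [inj_i ie]]] := kernel_exists e.
have [e' e'P] : exists e' : {linear G 1%N -> Z}, forall x, i (e' x) = d 0%N x.
  by apply: factor_inj => // x; apply/ie/de; exists x.
have Sie : short_exact i e by [].
apply: (ext_vanish_quotient Sie); last first.
  exact/gorenstein_projective_ext_vanish/Ggp.
apply: IHn; exists (fun m => G m.+1), (fun m => d m.+1), e'; split=> //.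
- by move=> m mn; apply: Ggp.
- by move=> m nm; apply: G0.
- move=> z; have /de[x xE] := short_exact_comp0 Sie z.
  by exists x; apply: inj_i; rewrite e'P.
- move=> y; rewrite -dd -e'P; split=> [->|]; first by rewrite raddf0.
  by rewrite -(raddf0 i) => /inj_i.
Qed.

(** [T] is the quotient of [P * A] by a copy of [B], so a map on [T] amounts to compatible maps on
    [P] and on [A]. *)
Lemma ext_vanish0_extend A T N (i : {linear A -> T}) (q : {linear T -> N})
    (f : {linear A -> Q}) :
    short_exact i q -> ext_vanish 0 N ->
  exists g : {linear T -> Q}, forall x, g (i x) = f x.
Proof.
move=> Siq [B [P [iB [p [Pproj Sip BQ]]]]].
have [inj_i iq surj_q] := Siq.
have [phi phiP] := Pproj _ _ q p surj_q.
have [t tP] : exists t : {linear B -> A}, forall x, i (t x) = (phi \o iB) x.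
  apply: (short_exact_factor Siq) => x /=.
  by rewrite phiP (short_exact_comp0 Sip).
have [g gP] := BQ (f \o t).
pose h : {linear (P * A)%type -> T} := (phi \o fst) \+ (i \o snd).
pose h' : {linear (P * A)%type -> Q} := (g \o fst) \+ (f \o snd).
have [|[x a] /= ha|v vP] := factor_surj (q := h) (u := h').
- move=> y; have [x px] : exists x, p x = q y by case: Sip => _ _; apply.
  have [|a ia] := (iq (y - phi x)).1; first by rewrite raddfB /= phiP px subrr.
  by exists (x, a); rewrite /= ia addrC subrK.
- have px : p x = 0.
    by rewrite -phiP -[phi x](addrK (i a)) ha sub0r raddfN /=
         (short_exact_comp0 Siq) oppr0.
  have [b xE] : exists b, iB b = x by case: Sip => _ ip _; apply/ip.
  rewrite -xE gP /= -raddfD; suff -> : t b + a = 0 by rewrite raddf0.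
  by apply: inj_i; rewrite raddfD /= tP /= xE ha raddf0.
exists v => a; have := vP (0, a); rewrite /= !raddf0 !add0r; exact.
Qed.

(* Since M is a stable retract of its syzygy, Ext^(k+1)(M, Q) embeds in
   Ext^(k+2)(M, Q). *)
Lemma ext_vanish_self_extension M T P (i : {linear M -> T})
    (q : {linear T -> M}) (j : {linear M -> P}) (tau : {linear P -> T}) k :
    enough_projectives ->
    short_exact i q -> projective P -> (forall x, tau (j x) = i x) ->
  ext_vanish k M -> ext_vanish 0 M.
Proof.
move=> enough Siq Pproj tauj; elim: k => // k IHk.
move=> [A [F [iA [p [Fproj Sip AQ]]]]]; apply: IHk.
apply: ext_vanish_retract AQ => //.
exact: stable_retract_syzygy Siq Pproj tauj Fproj Sip.
Qed.

End ExtVanishing.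

(** * Consequences of finite Gorenstein global dimension *)

Lemma G_gldim_finite (S : comPzRingType) : G_gldim S <> enat_infty ->
  forall N : lmodType S, exists n, gproj_resolution N n.
Proof.
rewrite /G_gldim /least; case: pselect => // -[n /asboolP gld] _ N.
have := gld N.
rewrite /Gpd /least; case: pselect => // exN /=.
by case: ex_minnP => m /asboolP mN _ _; exists m.
Qed.

(** [N] is covered by [G 0], which is the image of the projective [C (-1)] in a totally acyclic
    complex. *)
Lemma gproj_resolution_enough_projectives (S : comPzRingType) :
    (forall N : lmodType S, exists n, gproj_resolution N n) ->
  enough_projectives S.
Proof.
move=> res M; have [n [G [d [e [Ggp _ surj_e _ _]]]]] := res M.
have [C [dC [[Cproj _ _] [u [inj_u u_im]]]]] := Ggp 0%N isT.
have [p pP] : exists p : {linear C (-1) -> G 0%N},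
    forall x, u (p x) = dC (-1) x.
  by apply: factor_inj => // x; apply/u_im; exists x.
exists (C (-1)), (e \o p); split=> // m.
have [y <-] := surj_e m.
have [x xE] := (u_im (u y)).1 (ex_intro _ y erefl).
by exists x => /=; congr (e _); apply: inj_u; rewrite pP.
Qed.

(** * Linear forms on a vector space of arbitrary dimension *)

Lemma linear_form_eq1 (F : fieldType) (E : lmodType F) (e0 : E) :
  e0 != 0 -> exists l : {linear E -> F^o}, l e0 = 1.
Proof.
move=> e0_neq0.
pose avoiding (H : set E) :=
  (forall a x y, H x -> H y -> H (a *: x + y)) /\ ~ H e0.
have [|H [[Hlin He0] Hmax]] := @Zorn_bigcup E avoiding.
  move=> C Cav Ctot; split; last by move=> [X /Cav[]].
  move=> a x y [X CX Xx] [Y CY Yy].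
  by have [XY|YX] := Ctot _ _ CX CY; [exists Y | exists X] => //;
     [have [Ylin _] := Cav _ CY | have [Xlin _] := Cav _ CX];
     [apply: Ylin => //; apply: XY | apply: Xlin => //; apply: YX].
have H0 : H 0.
  apply: contrapT => nH0; have nH x : ~ H x.
    by move=> Hx; apply: nH0; rewrite -(addNr x) -scaleN1r; apply: Hlin.
  apply: (Hmax [set 0]%classic); last split.
  - by split=> [x /nH//|/(_ 0 erefl)].
  - by move=> a x y /= -> ->; rewrite scaler0 addr0.
  - by move/eqP; apply/negP.
have HZ a x : H x -> H (a *: x).
  by move=> Hx; rewrite -[_ *: _]addr0; apply: Hlin.
(* Otherwise the span of [H] and [x] would be strictly larger than [H] and still avoid [e0]: from
   [e0 - a x] in [H], with [a] nonzero, one solves for [x] modulo [H]. *)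
have Hspan x : exists c : F^o, H (x - c *: e0).
  apply: contrapT => nx.
  apply: (Hmax [set y | exists a, H (y - a *: x)]%classic); last split.
  - split=> [y Hy|/(_ x)]; first by exists 0; rewrite scale0r subr0.
    move=> /(_ _) Hx; apply: nx; exists 0; rewrite scale0r subr0; apply: Hx.
    by exists 1; rewrite scale1r subrr.
  - move=> a y z [b yb] [c zc]; exists (a * b + c).
    rewrite scalerDl opprD addrACA -scalerA -scalerBr; exact: Hlin.
  - move=> [a Ha]; have a_neq0 : a != 0.
      by apply/eqP => a0; apply: He0; move: Ha; rewrite a0 scale0r subr0.
    apply: nx; exists a^-1; have := HZ (- a^-1) _ Ha.
    by rewrite scaleNr scalerBr scalerA mulVf// scale1r opprB.
have He0Z (c : F) : H (c *: e0) -> c = 0.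
  move=> Hc; apply: contrapT => /eqP c_neq0; apply: He0.
  by rewrite -[e0]scale1r -(mulVf c_neq0) -scalerA; apply: HZ.
have [||c|l lP] := @linear_of_graph F E F^o (fun x c => H (x - c *: e0)).
- exact: Hspan.
- move=> a x c y d xc yd.
  by rewrite scalerDl opprD addrACA -scalerA -scalerBr; apply: Hlin.
- by rewrite sub0r -scaleNr => /He0Z/eqP; rewrite oppr_eq0 => /eqP.
exists l; have := lP e0; rewrite -[X in H (X - _)]scale1r -scalerBl => /He0Z.
by move/eqP; rewrite subr_eq0 => /eqP.
Qed.

(** * The fraction field and its dual numbers as modules over the trivial extension *)

Section TrivextMorphisms.
Variables (D : idomainType) (E : lmodType {fraction D}).
Local Notation K := {fraction D}.
Local Notation R := (trivext (restrict_scalars (@tofrac D) E)).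

Definition trivext_tofrac (r : R) : K := tofrac r.1.

Fact trivext_tofrac_zmod : zmod_morphism trivext_tofrac.
Proof. by move=> r s; rewrite /trivext_tofrac -tofracB. Qed.

Fact trivext_tofrac_monoid : monoid_morphism trivext_tofrac.
Proof.
by split=> [|r s]; rewrite /trivext_tofrac; [exact: tofrac1 | rewrite -tofracM].
Qed.

HB.instance Definition _ :=
  GRing.isZmodMorphism.Build R K trivext_tofrac trivext_tofrac_zmod.
HB.instance Definition _ :=
  GRing.isMonoidMorphism.Build R K trivext_tofrac trivext_tofrac_monoid.

Variable l : {linear E -> K^o}.

Definition trivext_form (r : R) : trivext (K^o : lmodType K) :=
  (tofrac r.1, l r.2).

Fact trivext_form_zmod : zmod_morphism trivext_form.
Proof.
by move=> r s; congr pair; rewrite /= -?raddfB// -tofracB.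
Qed.

Fact trivext_form_monoid : monoid_morphism trivext_form.
Proof.
split=> [|r s]; congr pair; rewrite /= ?tofrac1 ?raddf0 ?tofracM//.
by rewrite raddfD /=; congr (_ + _); exact: linearZ.
Qed.

HB.instance Definition _ :=
  GRing.isZmodMorphism.Build R (trivext (K^o : lmodType K)) trivext_form
    trivext_form_zmod.
HB.instance Definition _ :=
  GRing.isMonoidMorphism.Build R (trivext (K^o : lmodType K)) trivext_form
    trivext_form_monoid.

Definition frac_module : lmodType R :=
  restrict_scalars trivext_tofrac (K^o : lmodType K).

Definition dual_numbers : lmodType R :=
  restrict_scalars trivext_form ((trivext (K^o : lmodType K))^o).

Lemma dual_numbers_short_exact :
  exists (i : {linear frac_module -> dual_numbers})
    (q : {linear dual_numbers -> frac_module}),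
  [/\ short_exact i q, forall k, i k = (0, k) & forall t, q t = t.1].
Proof.
have [|i iE] := @linear_bundle _ frac_module dual_numbers (fun k => (0, k)).
  move=> a k k'; congr pair; rewrite /= ?mulr0 ?addr0//.
  by congr (_ + _); rewrite /= scale0r addr0.
have [|q qE] := @linear_bundle _ dual_numbers frac_module (fun t => t.1).
  by [].
exists i, q; split=> //; split=> [k k'|[x y]|k].
- by rewrite !iE => -[].
- rewrite qE /=; split=> [->|[k]]; first by exists y; rewrite iE.
  by rewrite iE => -[<-].
- by exists (k, 0); rewrite qE.
Qed.

End TrivextMorphisms.

(** * Factoring [i] through [R], and the units forced by an extension to [T] *)

Section FracModule.
Variables (D : idomainType) (E : lmodType {fraction D}).
Variables (e0 : E) (l : {linear E -> {fraction D}^o}).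
Hypotheses (e0_neq0 : e0 != 0) (le0 : l e0 = 1).
Local Notation K := {fraction D}.
Local Notation R := (trivext (restrict_scalars (@tofrac D) E)).

Lemma frac_module_embedding :
  exists j : {linear frac_module E -> R^o}, forall k : K, j k = (0, k *: e0).
Proof.
apply: (@linear_bundle _ (frac_module E) R^o (fun k => (0, (k : K) *: e0))).
move=> a k k'; congr pair; rewrite /= ?mulr0 ?addr0//.
rewrite scale0r addr0 scalerDl; congr (_ + _).
exact: esym (scalerA (tofrac a.1) (k : K) e0).
Qed.

Lemma dual_numbers_generator (i : {linear frac_module E -> dual_numbers l})
    (j : {linear frac_module E -> R^o}) :
    (forall k : K, i k = (0, k)) -> (forall k : K, j k = (0, k *: e0)) ->
  exists tau : {linear R^o -> dual_numbers l}, forall k, tau (j k) = i k.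
Proof.
move=> iE jE.
have [|tau tauE] := @linear_bundle _ R^o (dual_numbers l)
  (fun r => (r : R) *: ((1, 0) : dual_numbers l)).
  by move=> a x y; rewrite scalerDl scalerA.
exists tau => k; rewrite tauE iE jE.
congr pair; rewrite /= ?mulr1 ?tofrac0//.
by rewrite scaler0 add0r scale1r linearZ /= le0; exact: mulr1.
Qed.

Lemma extension_inverts_nonzero (i : {linear frac_module E -> dual_numbers l})
    (g : {linear dual_numbers l -> R^o}) :
    (forall k : K, i k = (0, k)) -> (forall k : K, g (i k) = (0, k *: e0)) ->
  forall a : D, a != 0 -> a \is a GRing.unit.
Proof.
move=> iE gE a a_neq0.
have aF_neq0 : tofrac a != 0 by rewrite tofrac_eq0.
pose one : dual_numbers l := (1, 0).
pose inva : dual_numbers l := ((tofrac a)^-1, 0).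
have one_inva : one = ((a, 0) : R) *: inva.
  congr pair; rewrite /= ?divff// ?mulfV//.
  by rewrite !raddf0 addr0.
(* Applying [g] to this turns the prescribed value [(0, e0)] of [g (i 1)] into a condition on the
   first component of [g one] alone, as [(0, e0)] annihilates the second. *)
have i1 : i (1 : K) = ((0, e0) : R) *: one.
  rewrite iE; congr pair; rewrite /= ?tofrac0 ?mul0r//.
  by rewrite scaler0 add0r le0 scale1r.
have g1 : (g one).1 = 1.
  have ge0 : tofrac (g one).1 *: e0 = e0.
    have /(congr1 snd) := gE 1; rewrite i1 linearZ /= scale0r add0r scale1r.
    exact.
  have : (tofrac (g one).1 - 1) *: e0 = 0 by rewrite scalerBl ge0 scale1r subrr.
  move/eqP; rewrite scaler_eq0 (negPf e0_neq0) orbF subr_eq0 -tofrac1.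
  by rewrite tofrac_eq => /eqP.
(* First components of [g one = a g(inva)] exhibit an inverse of [a] inside [D]. *)
have /(congr1 fst) := congr1 g one_inva.
rewrite linearZ /= g1 => /esym a_inv.
by apply/unitrPr; exists (g inva).1.
Qed.

End FracModule.

Theorem theorem3p5 (D : idomainType) (E : lmodType {fraction D})
    (D_not_field : ~ (forall x : D, x != 0 -> x \is a GRing.unit))
    (E_neq0 : exists e : E, e != 0) :
  G_gldim (trivext (restrict_scalars (@tofrac D) E)) = enat_infty.
Proof.
apply: contrapT => /G_gldim_finite res.
have enough : enough_projectives (trivext (restrict_scalars (@tofrac D) E)).
  exact: gproj_resolution_enough_projectives.
have [e0 e0_neq0] := E_neq0; have [l le0] := linear_form_eq1 e0_neq0.
have [i [q [Siq iE _]]] := dual_numbers_short_exact l.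
have [j jE] := frac_module_embedding e0.
have [tau tauj] := dual_numbers_generator le0 iE jE.
have [m resK] := res (frac_module E).
have Rproj := @regular_projective (trivext (restrict_scalars (@tofrac D) E)).
have extK := gproj_resolution_ext_vanish enough Rproj resK.
have ext1K := ext_vanish_self_extension enough Siq Rproj tauj extK.
have [g gj] := ext_vanish0_extend j Siq ext1K.
apply: D_not_field; apply: (extension_inverts_nonzero e0_neq0 le0 iE) => k.
exact: etrans (gj k) (jE k).
Qed.
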